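(* Let $p>3$ be a prime. Then the following polynomial congruences hold in $\mathbb{Z}_{(p)}[t]$: \begin{align*} \sum_{k=0}^{p-1} \binom{2k}{k} t^{p-1-k} &\equiv 2u_p(t,t)-u_p(2-t) -2p^2\sum_{k=1}^{p-1}\frac{u_k(2-t)+u_k(t,t)}{k^2} \pmod{p^3}, \\ \sum_{k=1}^{p-1} \frac{\binom{2k}{k}}{k}\,t^{p-k} &\equiv \frac{3t^p+2-v_p(2-t)-4v_p(t,t)}{p} \pmod{p^2}, \\ \frac{1}{2}\sum_{k=1}^{p-1} \frac{\binom{2k}{k}}{k^2}\,t^{p-k} &\equiv \frac{v_p(2-t)+2v_p(t,t)-t^p-2}{p^2}+\sum_{k=1}^{p-1} \frac{v_{k}(2-t)}{k^2} \pmod{p}. \end{align*}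
   Context: The two-variable Lucas polynomials are defined by $u_0(x,y)=0$, $u_1(x,y)=1$, $u_n(x,y)=x\,u_{n-1}(x,y)-y\,u_{n-2}(x,y)$ for $n>1$, and $v_0(x,y)=2$, $v_1(x,y)=x$, $v_n(x,y)=x\,v_{n-1}(x,y)-y\,v_{n-2}(x,y)$ for $n>1$; one writes $u_n(x)=u_n(x,1)$ and $v_n(x)=v_n(x,1)$. $\mathbb{Z}_{(p)}$ denotes the rationals whose denominators are prime to $p$; for polynomials $A,B\in\mathbb{Q}[t]$, $A\equiv B\pmod{p^m}$ means that $A-B\in p^m\mathbb{Z}_{(p)}[t]$. *)

(* Defs.v *)
From mathcomp Require Import all_boot all_order all_algebra.
Set Implicit Arguments.
Unset Strict Implicit.
Unset Printing Implicit Defensive.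
Import GRing.Theory.
Local Open Scope ring_scope.

(* The two-variable Lucas polynomials u_n(x, y) and v_n(x, y), given by their
   values at elements x, y of an arbitrary commutative ring, so that x and y
   can be indeterminates as well as polynomials in t substituted for them. *)
Fixpoint lucas_u (R : comNzRingType) (x y : R) (n : nat) : R :=
  match n with
  | 0 => 0
  | n1.+1 => match n1 with
             | 0 => 1
             | n2.+1 => x * lucas_u x y n1 - y * lucas_u x y n2
             end
  end.

Fixpoint lucas_v (R : comNzRingType) (x y : R) (n : nat) : R :=
  match n with
  | 0 => 2
  | n1.+1 => match n1 with
             | 0 => x
             | n2.+1 => x * lucas_v x y n1 - y * lucas_v x y n2
             end
  end.

Definition lucas_u1 (R : comNzRingType) (x : R) (n : nat) : R := lucas_u x 1 n.
Definition lucas_v1 (R : comNzRingType) (x : R) (n : nat) : R := lucas_v x 1 n.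

(* Z_(p), as a subset of rat; denq is the reduced denominator. *)
Definition Zloc (p : nat) : {pred rat} := [pred r | coprime `|denq r|%N p].

(* A = B mod p^m, i.e. A - B lies in p^m Z_(p)[t]. *)
Definition polycong (p m : nat) (A B : {poly rat}) : Prop :=
  exists2 C : {poly rat},
    C \is a polyOver (Zloc p) & A - B = (p ^ m)%:R *: C.

(* Main.v *)
(* Put x = 2 - t = z + 1/z, so that v_k(x) = z^k + z^(-k).  The central binomial
   sum and t^p expand in the u_j(x) and v_j(x) with coefficients
   (-1)^j C(2p, p + j), while u_p(t, t) and v_p(t, t), being attached to the roots
   1 - z and 1 - 1/z, expand with coefficients (-1)^j C(p, j).  Modulo p^3 these
   coefficients are explicit in terms of 1/j, 1/j^2 and the harmonic numbers, and
   the first congruence follows by comparing coefficients.  The other two are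
   obtained from it by integration: the operator t d/dt - p turns
   sum C(2k,k)/k^(i+1) t^(p-k) into - sum C(2k,k)/k^i t^(p-k), and it is invertible
   over Z_(p) on the coefficients of t, ..., t^(p-1). *)

Require Import Defs.
From HB Require Import structures.
From mathcomp Require Import all_boot all_order all_algebra.
From mathcomp Require Import ring zify.
Import GRing.Theory.
Local Open Scope ring_scope.

(** * Lucas polynomials and binomial sums *)

Lemma lucas_vE (R : comNzRingType) (x y : R) n :
  lucas_v x y n.+1 = x * lucas_u x y n.+1 - 2 * y * lucas_u x y n.
Proof.
suff: lucas_v x y n.+1 = x * lucas_u x y n.+1 - 2 * y * lucas_u x y n /\
      lucas_v x y n.+2 = x * lucas_u x y n.+2 - 2 * y * lucas_u x y n.+1.
  by case.
elim: n => [|n [IH1 IH2]]; first by split => /=; ring.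
split=> //.
have -> : lucas_v x y n.+3 = x * lucas_v x y n.+2 - y * lucas_v x y n.+1 by [].
by rewrite IH1 IH2 /=; ring.
Qed.

(** Chain rule: as the power sum of the two roots, v_m has partial derivatives m u_m in x and -m
    u_(m-1) in y. The factor m becomes p at index p and is what later cancels denominators. *)
Lemma deriv_lucas_v (R : comNzRingType) (x y : {poly R}) n :
  (lucas_v x y n.+1)^`() =
  n.+1%:R * (lucas_u x y n.+1 * x^`() - lucas_u x y n * y^`()).
Proof.
suff: (lucas_v x y n.+1)^`() =
        n.+1%:R * (lucas_u x y n.+1 * x^`() - lucas_u x y n * y^`()) /\
      (lucas_v x y n.+2)^`() =
        n.+2%:R * (lucas_u x y n.+2 * x^`() - lucas_u x y n.+1 * y^`()).
  by case.
elim: n => [|n [IH1 IH2]].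
  split => /=; first by ring.
  have d2 : (2 : {poly R})^`() = 0 by rewrite derivMn -[1]/(1%:P) derivC mul0rn.
  by rewrite derivB !derivM d2; ring.
split=> //.
have -> : lucas_v x y n.+3 = x * lucas_v x y n.+2 - y * lucas_v x y n.+1 by [].
rewrite derivB !derivM IH1 IH2 !lucas_vE.
have -> : lucas_u x y n.+3 = x * lucas_u x y n.+2 - y * lucas_u x y n.+1 by [].
have -> : lucas_u x y n.+2 = x * lucas_u x y n.+1 - y * lucas_u x y n by [].
by rewrite -!(natr1 n.+2) -!(natr1 n.+1); ring.
Qed.

(* The sum over j >= 1 is one half of the two-sided sum, in which multiplication
   by t is the shift n -> n.+1; the last two terms are the boundary defect. *)
Lemma central_bin_sumS (R : comNzRingType) (t : R) (g : nat -> R) n :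
  (forall j, g j.+2 = (t - 2) * g j.+1 - g j) ->
  \sum_(1 <= j < n.+2) 'C(2 * n.+1, n.+1 + j)%:R * g j =
  t * (\sum_(1 <= j < n.+1) 'C(2 * n, n + j)%:R * g j)
    + 'C(2 * n, n)%:R * g 1%N - 'C(2 * n, n.+1)%:R * g 0%N.
Proof.
move=> gE.
(* Pascal's rule twice. The weights 1, 2, 1 match the recurrence of [g] rewritten as
   [t * g j.+1 = g j.+2 + 2 * g j.+1 + g j]. *)
have binS j : 'C(2 * n.+1, n.+1 + j.+1) =
    ('C(2 * n, n + j.+2) + 'C(2 * n, n + j.+1) * 2 + 'C(2 * n, n + j))%N.
  by rewrite mulnS add2n !addnS !addSn !binS; lia.
have bin0 j : (n < j)%N -> 'C(2 * n, n + j) = 0%N.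
  by move=> lt_nj; rewrite bin_small // mul2n -addnn ltn_add2l.
pose c j : R := 'C(2 * n, n + j)%:R.
have cut m : (n <= m)%N ->
    \sum_(0 <= j < m) c j.+1 * g j.+1 = \sum_(0 <= j < n) c j.+1 * g j.+1.
  move=> le_nm; rewrite (@big_cat_nat _ _ _ n) //= [X in _ + X]big_nat_cond.
  rewrite [X in _ + X]big1 ?addr0 // => j /andP[/andP[le_nj _] _].
  by rewrite /c bin0 // mul0r.
rewrite !big_add1 /=.
under eq_bigr do rewrite binS !natrD natrM !mulrDl.
rewrite !big_split /= -/(c _).
have -> : \sum_(0 <= j < n.+1) c j.+2 * g j.+1 =
          \sum_(0 <= j < n.+2) c j.+1 * g j - c 1%N * g 0%N.
  by rewrite [X in _ = X - _]big_nat_recl // addrC addKr.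
have -> : \sum_(0 <= j < n.+1) c j * g j.+1 =
          \sum_(0 <= j < n) c j.+1 * g j.+2 + c 0%N * g 1%N.
  by rewrite big_nat_recl // addrC.
have -> : \sum_(0 <= j < n.+2) c j.+1 * g j = \sum_(0 <= j < n) c j.+1 * g j.
  rewrite (@big_cat_nat _ _ _ n) //= ?leqW // [X in _ + X]big_nat_cond.
  rewrite [X in _ + X]big1 ?addr0 // => j /andP[/andP[le_nj _] _].
  by rewrite /c bin0 // mul0r.
have -> : \sum_(0 <= j < n.+1) c j.+1 * 2 * g j.+1 =
          2 * \sum_(0 <= j < n) c j.+1 * g j.+1.
  by rewrite -(cut n.+1) // mulr_sumr; apply: eq_bigr => j _; ring.
have -> : t * (\sum_(0 <= j < n) c j.+1 * g j.+1) =
    \sum_(0 <= j < n) c j.+1 * g j + 2 * (\sum_(0 <= j < n) c j.+1 * g j.+1)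
    + \sum_(0 <= j < n) c j.+1 * g j.+2.
  rewrite !mulr_sumr -!big_split /=; apply: eq_bigr => j _; rewrite gE; ring.
by rewrite /c addn0 addn1; ring.
Qed.

(** Passing from n to n+1 multiplies the left side by t and adds C(2n, n). This is the boundary
    defect of [central_bin_sumS], because [g 0] is 0 and [g 1] is -1. *)
Lemma sum_central_bin (R : comNzRingType) (t : R) n :
  \sum_(0 <= k < n) 'C(2 * k, k)%:R * t ^+ (n - 1 - k) =
  - \sum_(1 <= j < n.+1) (-1) ^+ j * 'C(2 * n, n + j)%:R * lucas_u (2 - t) 1 j.
Proof.
pose g j := (-1) ^+ j * lucas_u (2 - t) 1 j.
have gE j : g j.+2 = (t - 2) * g j.+1 - g j by rewrite /g /= !exprS; ring.
have -> : \sum_(1 <= j < n.+1) (-1) ^+ j * 'C(2 * n, n + j)%:R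
            * lucas_u (2 - t) 1 j
        = \sum_(1 <= j < n.+1) 'C(2 * n, n + j)%:R * g j.
  by apply: eq_bigr => j _; rewrite /g; ring.
elim: n => [|n IH]; first by rewrite !big_geq ?oppr0.
rewrite (central_bin_sumS _ t) // big_nat_recr //= subn1 subnn expr0.
have -> : \sum_(0 <= i < n) 'C(2 * i, i)%:R * t ^+ (n - i) =
          t * \sum_(0 <= k < n) 'C(2 * k, k)%:R * t ^+ (n - 1 - k).
  rewrite mulr_sumr !big_nat; apply: eq_bigr => j /andP[_ lt_jn].
  by rewrite [RHS]mulrCA -exprS; congr (_ * _ ^+ _); lia.
by rewrite IH /g /=; ring.
Qed.

(** With 2 - t = z + 1/z one has t = -(1 - z)^2/z, so this is the binomial expansion of (1 - z)^(2n)
    divided by (-z)^n, with the terms j and -j grouped. *)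
Lemma exp_central_bin (R : comNzRingType) (t : R) n :
  t ^+ n = 'C(2 * n, n)%:R +
  \sum_(1 <= j < n.+1) (-1) ^+ j * 'C(2 * n, n + j)%:R * lucas_v (2 - t) 1 j.
Proof.
pose g j := (-1) ^+ j * lucas_v (2 - t) 1 j.
have gE j : g j.+2 = (t - 2) * g j.+1 - g j by rewrite /g /= !exprS; ring.
have -> : \sum_(1 <= j < n.+1) (-1) ^+ j * 'C(2 * n, n + j)%:R
            * lucas_v (2 - t) 1 j
        = \sum_(1 <= j < n.+1) 'C(2 * n, n + j)%:R * g j.
  by apply: eq_bigr => j _; rewrite /g; ring.
elim: n => [|n IH]; first by rewrite !big_geq ?addr0 ?bin0.
rewrite (central_bin_sumS _ t) // exprS IH /g /=.
have -> : 'C(2 * n.+1, n.+1) = ('C(2 * n, n) * 2 + 'C(2 * n, n.+1) * 2)%N.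
  rewrite mulnS add2n binS -[X in (_ + X)%N]bin_sub ; last by lia.
  have -> : ((2 * n).+1 - n = n.+1)%N by lia.
  by rewrite binS; lia.
by rewrite natrD !natrM; ring.
Qed.

(** The transform sends the powers of z and 1/z, where x = z + 1/z, to the powers of 1 - z and 1 -
    1/z. These two have sum and product both equal to 2 - x. *)
Lemma binomial_transform_rec (R : comNzRingType) (x : R) (w : nat -> R) n :
  (forall j, w j.+2 = x * w j.+1 - w j) ->
  let b m := \sum_(0 <= k < m.+1) (-1) ^+ k * 'C(m, k)%:R * w k in
  b n.+2 = (2 - x) * b n.+1 - (2 - x) * b n.
Proof.
move=> wE b.
(* The index [i] records a shift of [w]. Raising [m] applies the identity minus the shift, and the
   shift itself satisfies the recurrence of [w]. *)
pose B m i := \sum_(0 <= k < m.+1) (-1) ^+ k * 'C(m, k)%:R * w (k + i)%N.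
have bB m : b m = B m 0%N by apply: eq_bigr => k _; rewrite addn0.
have BS m i : B m.+1 i = B m i - B m i.+1.
  rewrite /B big_nat_recl // bin0 expr0.
  under eq_bigr do rewrite binS natrD mulrDr mulrDl.
  rewrite big_split /= [X in _ + (X + _)]big_nat_recr //= bin_small //.
  rewrite mulr0 mul0r addr0 addrA [in RHS]big_nat_recl // bin0 expr0; congr (_ + _).
  by rewrite -sumrN; apply: eq_bigr => k _; rewrite exprS addnS addSn; ring.
have Brec m i : B m i.+2 = x * B m i.+1 - B m i.
  rewrite /B mulr_sumr -sumrB; apply: eq_bigr => k _.
  by rewrite !addnS wE; ring.
by rewrite !bB !BS Brec; ring.
Qed.

(** The minus sign arises because (1 - z) - (1 - 1/z) is the opposite of z - 1/z. *)
Lemma lucas_u_transform (R : comNzRingType) (t : R) n :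
  lucas_u t t n =
  - \sum_(1 <= k < n.+1) (-1) ^+ k * 'C(n, k)%:R * lucas_u (2 - t) 1 k.
Proof.
pose b m := \sum_(0 <= k < m.+1) (-1) ^+ k * 'C(m, k)%:R * lucas_u (2 - t) 1 k.
have -> : \sum_(1 <= k < n.+1) (-1) ^+ k * 'C(n, k)%:R * lucas_u (2 - t) 1 k = b n.
  by rewrite /b [RHS]big_ltn // mulr0 add0r.
have bE m : b m.+2 = t * b m.+1 - t * b m.
  have -> : t = 2 - (2 - t) by ring.
  apply: (@binomial_transform_rec _ (2 - t) (lucas_u (2 - t) 1)) => j /=; ring.
suff: lucas_u t t n = - b n /\ lucas_u t t n.+1 = - b n.+1 by case.
elim: n => [|n [IH1 IH2]].
  by split; rewrite /b !big_nat_recr //= big_geq // ?binn ?bin0 /=; ring.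
split=> //; have -> : lucas_u t t n.+2 = t * lucas_u t t n.+1 - t * lucas_u t t n by [].
by rewrite bE IH1 IH2; ring.
Qed.

Lemma lucas_v_transform (R : comNzRingType) (t : R) n :
  lucas_v t t n =
  \sum_(0 <= k < n.+1) (-1) ^+ k * 'C(n, k)%:R * lucas_v (2 - t) 1 k.
Proof.
pose b m := \sum_(0 <= k < m.+1) (-1) ^+ k * 'C(m, k)%:R * lucas_v (2 - t) 1 k.
have bE m : b m.+2 = t * b m.+1 - t * b m.
  have -> : t = 2 - (2 - t) by ring.
  apply: (@binomial_transform_rec _ (2 - t) (lucas_v (2 - t) 1)) => j /=; ring.
suff: lucas_v t t n = b n /\ lucas_v t t n.+1 = b n.+1 by case.
elim: n => [|n [IH1 IH2]].
  by split; rewrite /b !big_nat_recr //= big_geq // ?binn ?bin0 /=; ring.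
split=> //; have -> : lucas_v t t n.+2 = t * lucas_v t t n.+1 - t * lucas_v t t n by [].
by rewrite bE IH1 IH2; ring.
Qed.

(** * Congruences between p-integral rationals *)

Lemma ZlocP p (r : rat) :
  reflect (exists n d, [/\ coprime d p, (0 < d)%N & r * d%:R = n%:~R]) (r \in Zloc p).
Proof.
apply: (iffP idP) => [cop_r | [n [d [cop_d d_gt0 rdE]]]].
  exists (numq r), `|denq r|%N; split=> //; first by rewrite absz_gt0 denq_eq0.
  by rewrite pmulrn absz_denq mulrC [_%:~R * r]mulrC -numqE.
apply: coprime_dvdl cop_d.
rewrite -(@Gauss_dvdr _ `|numq r|) 1?coprime_sym ?coprime_num_den //.
have: (numq r * d)%Z = (n * denq r)%Z.
  apply: (@intr_inj rat); rewrite !intrM numqE -rdE -pmulrn; ring.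
by move=> /(congr1 absz); rewrite !abszM absz_nat => ->; exact: dvdn_mull.
Qed.

Lemma Zloc_subring p : subring_closed (Zloc p).
Proof.
split=> [|r s /ZlocP[a [c [cc c0 ra]]] /ZlocP[b [d [cd d0 sb]]]
         |r s /ZlocP[a [c [cc c0 ra]]] /ZlocP[b [d [cd d0 sb]]]].
- by apply/ZlocP; exists 1, 1%N; rewrite coprime1n mulr1.
- apply/ZlocP; exists (a * d - b * c)%R, (c * d)%N.
  split; rewrite ?coprimeMl ?cc ?muln_gt0 ?c0 //.
  by rewrite intrB !intrM -ra -sb -!pmulrn natrM; ring.
- apply/ZlocP; exists (a * b)%R, (c * d)%N.
  split; rewrite ?coprimeMl ?cc ?muln_gt0 ?c0 //.
  by rewrite intrM -ra -sb natrM; ring.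
Qed.

HB.instance Definition _ p := GRing.isSubringClosed.Build rat (Zloc p) (Zloc_subring p).

Lemma Zloc_invn p k : (0 < k)%N -> coprime k p -> k%:R^-1 \in Zloc p.
Proof.
move=> k_gt0 cop_k; apply/ZlocP; exists 1, k; split=> //.
by rewrite mulVf // Num.Theory.pnatr_eq0 -lt0n.
Qed.

(** The ideal p^m Z_(p), given as a predicate closed under subtraction so that [polyOver] and the
    [rpred] lemmas turn congruences of polynomials into membership. *)
Definition Zpow p m : {pred rat} := [pred r | r / p%:R ^+ m \in Zloc p].

Lemma ZpowE p m r : (r \in Zpow p m) = (r / p%:R ^+ m \in Zloc p).
Proof. by []. Qed.

Lemma Zpow_zmod p m : zmod_closed (Zpow p m).
Proof.
split=> [|r s]; first by rewrite ZpowE mul0r rpred0.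
by rewrite !ZpowE mulrBl => *; apply: rpredB.
Qed.

HB.instance Definition _ p m := GRing.isZmodClosed.Build rat (Zpow p m) (Zpow_zmod p m).

Lemma ZpowP p m r : (0 < p)%N ->
  reflect (exists2 c, c \in Zloc p & r = p%:R ^+ m * c) (r \in Zpow p m).
Proof.
move=> p_gt0; have p0 : p%:R ^+ m != 0 :> rat.
  by rewrite expf_eq0 Num.Theory.pnatr_eq0 eqn0Ngt p_gt0 andbF.
rewrite ZpowE; apply: (iffP idP) => [rZ | [c cZ ->]].
  by exists (r / p%:R ^+ m) => //; rewrite mulrC divfK.
by rewrite mulrC mulKf.
Qed.

Lemma polyOver_ZpowP p m (A : {poly rat}) : (0 < p)%N ->
  reflect (exists2 C : {poly rat}, C \is a polyOver (Zloc p) & A = (p ^ m)%:R *: C)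
          (A \is a polyOver (Zpow p m)).
Proof.
move=> p_gt0; have p0 : (p ^ m)%:R != 0 :> rat.
  by rewrite Num.Theory.pnatr_eq0 expn_eq0 eqn0Ngt p_gt0.
apply: (iffP polyOverP) => [AZ | [C /polyOverP CZ ->] i]; last first.
  by apply/ZpowP => //; exists C`_i; rewrite // coefZ natrX.
exists ((p ^ m)%:R^-1 *: A); last by rewrite scalerA divff ?scale1r.
by apply/polyOverP => i; have := AZ i; rewrite ZpowE coefZ mulrC natrX.
Qed.

Lemma polycongP p m (A B : {poly rat}) : (0 < p)%N ->
  A - B \is a polyOver (Zpow p m) -> polycong p m A B.
Proof. by move=> p_gt0 /polyOver_ZpowP-/(_ p_gt0). Qed.

Lemma Zpow_leq p m n r : (0 < p)%N -> (m <= n)%N -> r \in Zpow p n -> r \in Zpow p m.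
Proof.
move=> p0 le_mn /(ZpowP _ _ _ p0)[c cZ ->]; apply/ZpowP => //.
exists (p%:R ^+ (n - m) * c); first by rewrite rpredM ?rpredX ?rpred_nat.
by rewrite mulrA -exprD subnKC.
Qed.

Lemma ZpowM p m r s : r \in Zpow p m -> s \in Zloc p -> r * s \in Zpow p m.
Proof. by rewrite !ZpowE mulrAC => rZ sZ; rewrite rpredM. Qed.

Lemma polyOver_ZpowM p m (A B : {poly rat}) :
  A \is a polyOver (Zpow p m) -> B \is a polyOver (Zloc p) ->
  A * B \is a polyOver (Zpow p m).
Proof.
move=> /polyOverP AZ /polyOverP BZ; apply/polyOverP => i.
by rewrite coefM rpred_sum // => j _; apply: ZpowM.
Qed.

Lemma polyOver_ZpowZ p m c (A : {poly rat}) :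
  c \in Zpow p m -> A \is a polyOver (Zloc p) -> c *: A \is a polyOver (Zpow p m).
Proof.
by move=> cZ /polyOverP AZ; apply/polyOverP => i; rewrite coefZ ZpowM.
Qed.

(** * Binomial coefficients modulo powers of p, through harmonic numbers *)

Definition harm n : rat := \sum_(1 <= i < n.+1) i%:R^-1.

Lemma harmS n : harm n.+1 = harm n + n.+1%:R^-1.
Proof. by rewrite /harm big_nat_recr. Qed.

Section Prime.
Variable p : nat.
Hypothesis p_prime : prime p.

Let p_gt0 : (0 < p)%N := prime_gt0 p_prime.

Lemma Zloc_inv_lt k : (0 < k < p)%N -> k%:R^-1 \in Zloc p.
Proof.
move=> /andP[k_gt0 lt_kp]; apply: Zloc_invn => //.
by rewrite coprime_sym prime_coprime // gtnNdvd.
Qed.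

Lemma Zloc_inv_addp k : (0 < k < p)%N -> (p + k)%:R^-1 \in Zloc p.
Proof.
move=> /andP[k_gt0 lt_kp]; apply: Zloc_invn; first by rewrite addn_gt0 p_gt0.
by rewrite coprime_sym prime_coprime // dvdn_addr // gtnNdvd.
Qed.

Lemma harm_Zloc k : (k < p)%N -> harm k \in Zloc p.
Proof.
move=> lt_kp; rewrite /harm big_nat rpred_sum // => i /andP[i_gt0 le_ik].
by rewrite Zloc_inv_lt // i_gt0 (leq_trans le_ik).
Qed.

Lemma natr_neq0 k : (0 < k)%N -> k%:R != 0 :> rat.
Proof. by rewrite Num.Theory.pnatr_eq0 -lt0n. Qed.

(** The left side is the product of 1 - p/i over 1 <= i <= k, truncated modulo p^2. *)
Lemma bin_pred_prime k : (k < p)%N -> exists2 c, c \in Zloc p &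
  (-1) ^+ k * 'C(p.-1, k)%:R = 1 - p%:R * harm k + p%:R ^+ 2 * c.
Proof.
elim: k => [|k IH] lt_kp.
  by exists 0; rewrite ?rpred0 // bin0 /harm big_geq //; ring.
have [c cZ cE] := IH (ltnW lt_kp).
have k0 : k.+1%:R != 0 :> rat by rewrite natr_neq0.
have hZ : harm k \in Zloc p by rewrite harm_Zloc // ltnW.
have kZ : k.+1%:R^-1 \in Zloc p by rewrite Zloc_inv_lt ?lt_kp.
exists (c * (1 - p%:R / k.+1%:R) + harm k / k.+1%:R).
  by rewrite !(rpredD, rpredN, rpredM, rpredX, rpred1, rpred_nat).
have binE : k.+1%:R * 'C(p.-1, k.+1)%:R = (p%:R - k.+1%:R) * 'C(p.-1, k)%:R :> rat.
  rewrite -natrM mul_bin_left natrM; congr (_ * _).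
  by rewrite -natrB ?(ltnW lt_kp) //; congr (_%:R); lia.
have -> : 'C(p.-1, k.+1)%:R = (p%:R - k.+1%:R) / k.+1%:R * 'C(p.-1, k)%:R :> rat.
  by rewrite mulrAC -binE mulrAC divff // mul1r.
have -> : (-1) ^+ k.+1 * ((p%:R - k.+1%:R) / k.+1%:R * 'C(p.-1, k)%:R)
    = ((-1) ^+ k * 'C(p.-1, k)%:R) * (1 - p%:R / k.+1%:R) :> rat.
  by rewrite exprS; field; rewrite nat1r.
by rewrite cE harmS; field; rewrite nat1r.
Qed.

(** From C(p, k) = (p/k) C(p-1, k-1), whose factor p gains one power of precision. Writing H_(k-1) =
    H_k - 1/k produces the term p/k^2. *)
Lemma bin_prime k : (0 < k < p)%N -> exists2 c, c \in Zloc p &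
  (-1) ^+ k * 'C(p, k)%:R =
  - p%:R * (k%:R^-1 + p%:R / k%:R ^+ 2 - p%:R * harm k / k%:R) + p%:R ^+ 3 * c.
Proof.
case: k => // k /andP[_ lt_kp].
have [c cZ cE] := bin_pred_prime k (ltnW lt_kp).
have k0 : k.+1%:R != 0 :> rat by rewrite natr_neq0.
have hZ : harm k \in Zloc p by rewrite harm_Zloc // ltnW.
have kZ : k.+1%:R^-1 \in Zloc p by rewrite Zloc_inv_lt ?lt_kp.
exists (- c / k.+1%:R); first by rewrite rpredM ?rpredN.
have binE : k.+1%:R * 'C(p, k.+1)%:R = p%:R * 'C(p.-1, k)%:R :> rat.
  by rewrite -!natrM mul_bin_diag.
have -> : 'C(p, k.+1)%:R = p%:R / k.+1%:R * 'C(p.-1, k)%:R :> rat.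
  by rewrite mulrAC -binE mulrAC divff // mul1r.
have -> : (-1) ^+ k.+1 * (p%:R / k.+1%:R * 'C(p.-1, k)%:R)
    = - (p%:R / k.+1%:R) * ((-1) ^+ k * 'C(p.-1, k)%:R) :> rat by rewrite exprS; ring.
by rewrite cE harmS; field; rewrite nat1r.
Qed.

(** By Vandermonde, C(2p, p) is the sum of the squares C(p, j)^2, and p^2 divides all but the two
    extreme ones. *)
Lemma central_bin_prime : exists2 c, c \in Zloc p &
  'C(2 * p, p)%:R = 2 + p%:R ^+ 2 * c.
Proof.
pose c := \sum_(1 <= j < p) (('C(p, j) %/ p) ^ 2)%N.
exists c%:R; first exact: rpred_nat.
rewrite mul2n -addnn -binomial.Vandermonde.
have -> : (\sum_(j < p.+1) 'C(p, j) * 'C(p, p - j) = 2 + p ^ 2 * c)%N.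
  rewrite -(big_mkord xpredT (fun j => 'C(p, j) * 'C(p, p - j)))%N.
  rewrite big_nat_recr //= big_ltn // bin0 subn0 binn subnn bin0 /c big_distrr /=.
  under [in RHS]eq_big_nat => j /andP[j_gt0 lt_jp].
    rewrite -expnMn mulnC divnK ?prime_dvd_bin ?j_gt0 //; over.
  rewrite !mul1n addnAC; congr addn.
  by apply: eq_big_nat => j /andP[_ lt_jp]; rewrite bin_sub ?(ltnW lt_jp).
by rewrite natrD natrM natrX.
Qed.

(** The start is C(2p-1, p) = C(2p, p)/2, which is 1 modulo p^2. Each step multiplies the signed
    coefficient by (i - p)/(i + p) = 1 - 2p/(p + i), which is 1 - 2p/i modulo p^2. *)
Lemma bin_double_pred_prime k : (2 < p)%N -> (0 < k <= p)%N -> exists2 c, c \in Zloc p &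
  (-1) ^+ k * 'C((2 * p).-1, p + k.-1)%:R = - (1 - 2 * p%:R * harm k.-1) + p%:R ^+ 2 * c.
Proof.
move=> p_gt2; case: k => // k; rewrite /= => lt_kp.
elim: k lt_kp => [|k IH] lt_kp.
  have [c cZ cE] := central_bin_prime.
  exists (- c / 2); first by rewrite rpredM ?rpredN // (Zloc_inv_lt 2).
  have binE : p%:R * 'C(2 * p, p)%:R = p%:R * (2 * 'C((2 * p).-1, p)%:R) :> rat.
    rewrite mulrCA -!natrM; congr _%:R.
    by rewrite mulnA mul_bin_down; congr (_ * _)%N; lia.
  have {}binE := mulfI (natr_neq0 _ p_gt0) binE.
  rewrite cE in binE; rewrite /harm big_geq // addn0.
  have -> : 'C((2 * p).-1, p)%:R = (2 + p%:R ^+ 2 * c) / 2 :> rat.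
    by rewrite binE mulrC mulKf.
  by field.
have [c cZ cE] := IH (ltnW lt_kp).
have k0 : k.+1%:R != 0 :> rat by rewrite natr_neq0.
have pk0 : (p + k.+1)%:R != 0 :> rat by rewrite natr_neq0 // addn_gt0 p_gt0.
have hZ : harm k \in Zloc p by rewrite harm_Zloc // ltnW.
have kZ : k.+1%:R^-1 \in Zloc p by rewrite Zloc_inv_lt ?lt_kp.
have pkZ : (p + k.+1)%:R^-1 \in Zloc p by rewrite Zloc_inv_addp ?lt_kp.
(* The last two terms are the cross term of the product and the error of replacing 1/(p + k + 1) by
   1/(k + 1). *)
exists (c * ((k.+1%:R - p%:R) / (p + k.+1)%:R) - 4 * harm k / (p + k.+1)%:R
        - 2 * k.+1%:R^-1 / (p + k.+1)%:R).
  by rewrite !(rpredD, rpredN, rpredM, rpredX, rpred1, rpred_nat).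
have binE : (p + k.+1)%:R * 'C((2 * p).-1, p + k.+1)%:R =
            (p%:R - k.+1%:R) * 'C((2 * p).-1, p + k)%:R :> rat.
  rewrite -natrM addnS mul_bin_left natrM; congr (_ * _).
  by rewrite -natrB ?(ltnW lt_kp) //; congr (_%:R); lia.
have -> : 'C((2 * p).-1, p + k.+1)%:R =
    (p%:R - k.+1%:R) / (p + k.+1)%:R * 'C((2 * p).-1, p + k)%:R :> rat.
  by rewrite mulrAC -binE mulrAC divff // mul1r.
have -> : (-1) ^+ k.+2 * ((p%:R - k.+1%:R) / (p + k.+1)%:R * 'C((2 * p).-1, p + k)%:R)
    = ((-1) ^+ k.+1 * 'C((2 * p).-1, p + k)%:R)
      * ((k.+1%:R - p%:R) / (p + k.+1)%:R) :> rat.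
  by rewrite !exprS; ring.
rewrite cE harmS; field.
by rewrite nat1r -natrD pk0 k0.
Qed.

(** From C(2p, p+k) = 2p/(p+k) C(2p-1, p+k-1), where 1/(p + k) is 1/k - p/k^2 modulo p^2. *)
Lemma bin_double_prime k : (2 < p)%N -> (0 < k < p)%N -> exists2 c, c \in Zloc p &
  (-1) ^+ k * 'C(2 * p, p + k)%:R =
  - 2 * p%:R * (k%:R^-1 + p%:R / k%:R ^+ 2 - 2 * p%:R * harm k / k%:R) + p%:R ^+ 3 * c.
Proof.
move=> p_gt2; case: k => // k /andP[_ lt_kp].
have [c cZ cE] := bin_double_pred_prime k.+1 p_gt2 (ltnW lt_kp).
have k0 : k.+1%:R != 0 :> rat by rewrite natr_neq0.
have pk0 : (p + k.+1)%:R != 0 :> rat by rewrite natr_neq0 // addn_gt0 p_gt0.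
have hZ : harm k \in Zloc p by rewrite harm_Zloc // ltnW.
have kZ : k.+1%:R^-1 \in Zloc p by rewrite Zloc_inv_lt ?lt_kp.
have pkZ : (p + k.+1)%:R^-1 \in Zloc p by rewrite Zloc_inv_addp ?lt_kp.
exists (2 * c / (p + k.+1)%:R - (2 * k.+1%:R^-1 ^+ 2 / (p + k.+1)%:R
   + 4 * harm k * k.+1%:R^-1 / (p + k.+1)%:R)).
  by rewrite !(rpredD, rpredN, rpredM, rpredX, rpred1, rpred_nat).
have binE : (p + k.+1)%:R * 'C(2 * p, p + k.+1)%:R =
            2 * p%:R * 'C((2 * p).-1, p + k)%:R :> rat.
  by rewrite -!natrM mul_bin_diag addnS.
have -> : 'C(2 * p, p + k.+1)%:R =
    2 * p%:R / (p + k.+1)%:R * 'C((2 * p).-1, p + k)%:R :> rat.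
  by rewrite mulrAC -binE mulrAC divff // mul1r.
have -> : (-1) ^+ k.+1 * (2 * p%:R / (p + k.+1)%:R * 'C((2 * p).-1, p + k)%:R)
    = 2 * p%:R / (p + k.+1)%:R * ((-1) ^+ k.+1 * 'C((2 * p).-1, p + k)%:R) :> rat by ring.
rewrite cE /= harmS; field.
by rewrite nat1r -natrD pk0 k0.
Qed.

End Prime.

(** * Binomial sums, and integrality and degree of Lucas polynomials *)

Lemma sum_bin_col n i : (\sum_(0 <= k < n) 'C(k, i) = 'C(n, i.+1))%N.
Proof.
by elim: n => [|n IH]; [rewrite big_geq | rewrite big_nat_recr //= IH binS addnC].
Qed.

Lemma sum_alt_bin (R : comNzRingType) k n :
  \sum_(0 <= j < n.+1) (-1) ^+ j * 'C(k.+1, j)%:R = (-1) ^+ n * 'C(k, n)%:R :> R.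
Proof.
elim: n => [|n IH]; first by rewrite big_nat1 !bin0.
by rewrite big_nat_recr //= IH binS natrD exprS; ring.
Qed.

Lemma lucas_u_polyOver (R : comNzRingType) (S : subringClosed R) (x y : {poly R}) n :
  x \is a polyOver S -> y \is a polyOver S -> lucas_u x y n \is a polyOver S.
Proof.
move=> xS yS; suff: lucas_u x y n \is a polyOver S /\ lucas_u x y n.+1 \is a polyOver S.
  by case.
elim: n => [|n [IH1 IH2]]; first by rewrite /= rpred0 rpred1.
by split=> //=; apply: rpredB; apply: rpredM.
Qed.

Lemma lucas_v_polyOver (R : comNzRingType) (S : subringClosed R) (x y : {poly R}) n :
  x \is a polyOver S -> y \is a polyOver S -> lucas_v x y n \is a polyOver S.
Proof.
move=> xS yS; suff: lucas_v x y n \is a polyOver S /\ lucas_v x y n.+1 \is a polyOver S.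
  by case.
elim: n => [|n [IH1 IH2]]; first by rewrite /= rpred_nat.
by split=> //=; apply: rpredB; apply: rpredM.
Qed.

(** The second argument has degree at most one, so its product with [f n] stays below the top degree
    of the first argument times [f n.+1]. This controls the coefficient of t^p, on which t d/dt - p
    vanishes. *)
Lemma lucas_v_lead (R : comNzRingType) (a b c d : R) n :
  let f := lucas_v (a%:P + b *: 'X) (c%:P + d *: 'X) in
  (size (f n) <= n.+1)%N /\ (f n.+1)`_n.+1 = b ^+ n.+1.
Proof.
move=> f.
have fE k : f k.+2 = (a *: f k.+1 + b *: ('X * f k.+1)) - (c *: f k + d *: ('X * f k)).
  by rewrite /f /= -!mul_polyC; ring.
have small k : (size (f k) <= k.+1)%N /\ (size (f k.+1) <= k.+2)%N.
  elim: k => [|k [IH1 IH2]].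
    split; first by rewrite /f /= -polyC_natr size_polyC_leq1.
    rewrite /f /= (leq_trans (size_polyD _ _)) // geq_max.
    rewrite (leq_trans (size_polyC_leq1 _)) //.
    by rewrite (leq_trans (size_scale_leq _ _)) // size_polyX.
  split=> //; rewrite fE.
  have szX (q : {poly R}) : (size ('X * q)%R <= (size q).+1)%N.
    by rewrite mulrC; have [->|q0] := eqVneq q 0; rewrite ?mul0r ?size_poly0 // size_mulX.
  have szZ e (q : {poly R}) m : (size q <= m)%N -> (size (e *: q) <= m)%N.
    exact: leq_trans (size_scale_leq _ _).
  rewrite (leq_trans (size_polyD _ _)) // size_polyN geq_max.
  rewrite !(leq_trans (size_polyD _ _)) // geq_max !szZ //.
  - by rewrite (leq_trans (szX _)) // ltnS leqW.
  - exact: leqW (leqW IH1).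
  - by rewrite (leq_trans (szX _)).
  - exact: leqW IH2.
split; first by case: (small n).
elim: n => [|n IH].
  by rewrite /f /= coefD coefZ coefX coefC mulr1 add0r.
rewrite fE coefB !coefD !coefZ !coefXM /= IH [(f n.+1)`_n.+2]nth_default;
  last by case: (small n).
have [sz _] := small n.
rewrite [(f n)`_n.+2]nth_default ?(leqW sz) // [(f n)`_n.+1]nth_default //.
by rewrite [RHS]exprS; ring.
Qed.

(** * Harmonic sums modulo p, and inversion of t d/dt - p *)

Section Prime.
Variable p : nat.
Hypotheses (p_prime : prime p) (p_gt2 : (2 < p)%N).

Let p_gt0 : (0 < p)%N := prime_gt0 p_prime.

(** Pair k with p - k: 1/k + 1/(p - k) = p/(k(p - k)). *)
Lemma harm_pred_prime : harm p.-1 \in Zpow p 1.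
Proof.
apply/ZpowP => //.
exists (2^-1 * \sum_(1 <= k < p) k%:R^-1 * (p - k)%:R^-1).
  have n2 : 2^-1 \in Zloc p by rewrite (Zloc_inv_lt _ p_prime 2).
  rewrite rpredM //.
  rewrite big_nat rpred_sum // => k k_int; rewrite rpredM ?Zloc_inv_lt //; lia.
have : 2 * harm p.-1 = p%:R * \sum_(1 <= k < p) k%:R^-1 * (p - k)%:R^-1.
  have -> : 2 * harm p.-1 = harm p.-1 + harm p.-1 by ring.
  rewrite /harm prednK // [X in _ + X]big_nat_rev -big_split mulr_sumr.
  apply: eq_big_nat => k /andP[k_gt0 lt_kp] /=; rewrite add1n subSS.
  have k0 := natr_neq0 k k_gt0; have pk0 : (p - k)%:R != 0 :> rat.
    by rewrite natr_neq0 // subn_gt0.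
  have -> : p%:R = k%:R + (p - k)%:R :> rat by rewrite -natrD subnKC // ltnW.
  by field; rewrite k0 pk0.
by move=> E; rewrite expr1 mulrCA -E mulKf.
Qed.

(** Summing C(k-1, i)/(i+1) = (C(k-1, i+1) + C(k-1, i))/k over k shows that two consecutive sums add
    up to C(p-1, i+1)/(i+1), which is (-1)^(i+1)/(i+1) modulo p. *)
Lemma sum_bin_pred_div i : (i < p)%N -> exists2 c, c \in Zloc p &
  \sum_(1 <= k < p) 'C(k.-1, i)%:R / k%:R = (-1) ^+ i * harm i + p%:R * c.
Proof.
elim: i => [|i IH] lt_ip.
  have /(ZpowP _ _ _ p_gt0)[c cZ cE] := harm_pred_prime.
  exists c => //; have -> : harm 0 = 0 by rewrite /harm big_geq.
  rewrite mulr0 add0r -[p%:R]expr1 -cE.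
  by rewrite /harm prednK //; apply: eq_bigr => k _; rewrite bin0 mul1r.
have [c cZ cE] := IH (ltnW lt_ip).
have [d dZ dE] := bin_pred_prime p p_prime i.+1 lt_ip.
have i0 := natr_neq0 i.+1 isT.
have iZ : i.+1%:R^-1 \in Zloc p by rewrite Zloc_inv_lt.
have hZ : harm i.+1 \in Zloc p by rewrite harm_Zloc.
have SE : \sum_(1 <= k < p) 'C(k.-1, i.+1)%:R / k%:R =
    'C(p.-1, i.+1)%:R / i.+1%:R - \sum_(1 <= k < p) 'C(k.-1, i)%:R / k%:R :> rat.
  rewrite -sum_bin_col natr_sum big_distrl /= !big_add1 -sumrB.
  apply: eq_bigr => k _ /=.
  have k0 := natr_neq0 k.+1 isT.
  have binE : k.+1%:R * 'C(k, i)%:R = i.+1%:R * ('C(k, i.+1) + 'C(k, i))%:R :> rat.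
    by rewrite -!natrM mul_bin_diag binS.
  have -> : 'C(k, i)%:R / i.+1%:R = ('C(k, i.+1) + 'C(k, i))%:R / k.+1%:R :> rat.
    by apply/eqP; rewrite eqr_div // mulrC binE mulrC.
  by rewrite natrD; ring.
exists ((-1) ^+ i.+1 * (- harm i.+1 + p%:R * d) / i.+1%:R - c).
  by rewrite !(rpredD, rpredN, rpredM, rpredX, rpred1, rpred_nat).
rewrite SE cE.
have -> : 'C(p.-1, i.+1)%:R = (-1) ^+ i.+1 * ((-1) ^+ i.+1 * 'C(p.-1, i.+1)%:R) :> rat.
  by rewrite mulrA -exprMn mulrNN mulr1 expr1n mul1r.
by rewrite dE (harmS i) exprS; field; rewrite nat1r.
Qed.

(** The opposite of the coefficient of u_j(2 - t) in the sum of u_k(t, t)/k^2. *)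
Definition bin_div2 j : rat := (-1) ^+ j * \sum_(1 <= k < p) 'C(k, j)%:R / k%:R ^+ 2.

(** Absorption C(k, j)/k = C(k-1, j-1)/j reduces this to [sum_bin_pred_div]. *)
Lemma bin_div2_prime j : (0 < j < p)%N -> exists2 c, c \in Zloc p &
  bin_div2 j = - harm j.-1 / j%:R + p%:R * c.
Proof.
case: j => // j /andP[_ lt_jp].
have [c cZ cE] := sum_bin_pred_div j (ltnW lt_jp).
have j0 := natr_neq0 j.+1 isT.
have jZ : j.+1%:R^-1 \in Zloc p by rewrite Zloc_inv_lt.
exists ((-1) ^+ j.+1 * c / j.+1%:R).
  by rewrite !(rpredD, rpredN, rpredM, rpredX, rpred1).
rewrite /bin_div2.
have -> : \sum_(1 <= k < p) 'C(k, j.+1)%:R / k%:R ^+ 2 =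
    (\sum_(1 <= k < p) 'C(k.-1, j)%:R / k%:R) / j.+1%:R :> rat.
  rewrite mulr_suml; apply: eq_big_nat => -[//|k] _ /=.
  have k0 := natr_neq0 k.+1 isT.
  have binE : k.+1%:R * 'C(k, j)%:R = j.+1%:R * 'C(k.+1, j.+1)%:R :> rat.
    by rewrite -!natrM mul_bin_diag.
  have -> : 'C(k.+1, j.+1)%:R = k.+1%:R * 'C(k, j)%:R / j.+1%:R :> rat.
    by rewrite binE mulrC mulKf.
  by field; rewrite !nat1r j0.
have s2 : (-1) ^+ j * (-1) ^+ j = 1 :> rat.
  by rewrite -exprMn mulrNN mulr1 expr1n.
have -> : harm j.+1.-1 = (-1) ^+ j * (-1) ^+ j * harm j by rewrite s2 mul1r.
by rewrite cE exprS; field; rewrite nat1r.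
Qed.

Lemma sum_harm_div n :
  2 * \sum_(1 <= j < n.+1) harm j.-1 / j%:R =
  harm n ^+ 2 - \sum_(1 <= j < n.+1) (j%:R ^+ 2)^-1.
Proof.
elim: n => [|n IH]; first by rewrite /harm !big_geq //; ring.
rewrite !(big_nat_recr n.+1) //= mulrDr IH harmS.
by field; rewrite nat1r natr_neq0.
Qed.

(** Let e be the sum of 1/(ij) over i < j < p. Modulo p, the sum [H2] equals e by the binomial sums
    [bin_div2], while 2e = H_(p-1)^2 - [H2] gives 2e = -[H2]. Hence 3 [H2] vanishes modulo p, and 3
    is invertible. *)
Lemma sum_inv_sq_prime : (3 < p)%N -> \sum_(1 <= k < p) (k%:R ^+ 2)^-1 \in Zpow p 1.
Proof.
move=> p_gt3; set H2 := \sum_(1 <= k < p) _.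
(* For 0 < k < p the alternating sum of row k of Pascal's triangle is 0, so its part with j >= 1 is
   -1. *)
have H2E : H2 = - \sum_(1 <= j < p) bin_div2 j.
  rewrite /bin_div2 -sumrN.
  under eq_bigr do rewrite mulr_sumr -sumrN.
  rewrite exchange_big_nat /=; apply: eq_big_nat => -[//|k] /andP[_ lt_kp].
  under eq_bigr do rewrite mulrA -mulNr.
  rewrite -mulr_suml sumrN.
  have := sum_alt_bin rat k p.-1; rewrite prednK // big_ltn // bin0 mulr1.
  rewrite bin_small; last by lia.
  by rewrite mulr0 => /eqP; rewrite addr_eq0 => /eqP <-; rewrite mul1r.
have : H2 - \sum_(1 <= j < p) harm j.-1 / j%:R \in Zpow p 1.
  rewrite H2E -opprD -big_split /= rpredN big_nat rpred_sum // => j j_int.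
  have [c cZ ->] := bin_div2_prime j j_int; apply/ZpowP => //; exists c => //.
  by rewrite expr1; ring.
have := sum_harm_div p.-1; rewrite prednK // -/H2 => sE.
move=> /ZpowP-/(_ p_gt0)[c cZ cE].
have /(ZpowP _ _ _ p_gt0)[h hZ hE] := harm_pred_prime.
have n3 : 3^-1 \in Zloc p by rewrite (Zloc_inv_lt _ p_prime 3).
apply/ZpowP => //; exists ((2 * c + p%:R * h ^+ 2) * 3^-1).
  by rewrite !(rpredD, rpredN, rpredM, rpredX, rpred1, rpred_nat).
have -> : H2 = (2 * (H2 - \sum_(1 <= j < p) harm j.-1 / j%:R) + harm p.-1 ^+ 2) / 3.
  by rewrite mulrBr sE; field.
by rewrite cE hE; field.
Qed.

(* Applied to P, the operator 'X d/d'X - p multiplies the coefficient of 'X^j by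
   j - p, a unit of Z_(p) when 0 < j < p. *)
Lemma polyOver_theta m (P : {poly rat}) :
  (size P <= p.+1)%N -> P`_0 \in Zpow p m -> P`_p \in Zpow p m ->
  'X * P^`() - p%:R *: P \is a polyOver (Zpow p m) -> P \is a polyOver (Zpow p m).
Proof.
move=> szP P0 Pp /polyOverP thP; apply/polyOverP => j.
case: j => [//|j]; have [lt_jp|] := ltnP j.+1 p; last first.
  rewrite leq_eqVlt => /predU1P[<-//|lt_pj].
  by rewrite nth_default ?rpred0 // (leq_trans szP).
have := thP j.+1; rewrite coefB coefXM coefZ coef_deriv /= => Hj.
have -> : P`_j.+1 = (P`_j.+1 *+ j.+1 - p%:R * P`_j.+1) * - (p - j.+1)%:R^-1.
  have: (p - j.+1)%:R != 0 :> rat by rewrite natr_neq0 // subn_gt0.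
  rewrite natrB ?(ltnW lt_jp) // -[P`_j.+1 *+ j.+1]mulr_natl => pj0.
  by field; rewrite nat1r.
by rewrite ZpowM // rpredN Zloc_inv_lt // subn_gt0 lt_jp; lia.
Qed.

End Prime.

(** * The polynomial congruences *)

Lemma Zpow_divp p m r : (0 < p)%N -> r \in Zpow p m.+1 -> p%:R^-1 * r \in Zpow p m.
Proof.
move=> p_gt0 /(ZpowP _ _ _ p_gt0)[c cZ ->]; apply/ZpowP => //; exists c => //.
by rewrite exprS -mulrA mulKf // natr_neq0.
Qed.

Lemma polyOver_Zpow_divp p m (A : {poly rat}) : (0 < p)%N ->
  A \is a polyOver (Zpow p m.+1) -> p%:R^-1 *: A \is a polyOver (Zpow p m).
Proof.
by move=> p_gt0 /polyOverP AZ; apply/polyOverP => i; rewrite coefZ Zpow_divp.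
Qed.

Lemma coef_natr (R : nzRingType) n j : (n%:R : {poly R})`_j = n%:R *+ (j == 0)%N.
Proof. by rewrite -polyC_natr coefC; case: (j == 0)%N. Qed.

Lemma coef0_lucas_v n : (lucas_v1 (2 - 'X) n : {poly rat})`_0 = 2.
Proof.
rewrite /lucas_v1; suff: (lucas_v (2 - 'X) 1 n : {poly rat})`_0 = 2 /\
  (lucas_v (2 - 'X) 1 n.+1 : {poly rat})`_0 = 2 by case.
have c2 : (2 : {poly rat})`_0 = 2 by rewrite coef_natr.
elim: n => [|n [IH1 IH2]]; first by rewrite /= coefB coefX c2 subr0.
split=> //.
have -> : lucas_v (2 - 'X) 1 n.+2 =
  (2 - 'X) * lucas_v (2 - 'X) 1 n.+1 - lucas_v (2 - 'X) 1 n :> {poly rat}.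
  by rewrite /=; ring.
by rewrite coefB coef0M coefB IH1 IH2 coefX c2 /=; ring.
Qed.

Lemma coef0_lucas_vX n : (lucas_v 'X 'X n.+1 : {poly rat})`_0 = 0.
Proof.
rewrite lucas_vE coefB -mulrA mulrCA !coefXM /=; ring.
Qed.

Lemma lucas_v1_lead n :
  (size (lucas_v1 (2 - 'X) n : {poly rat}) <= n.+1)%N /\
  (lucas_v1 (2 - 'X) n.+1 : {poly rat})`_n.+1 = (-1) ^+ n.+1.
Proof.
rewrite /lucas_v1; have := @lucas_v_lead rat 2 (-1) 1 0 n.
have -> : 2%:P + -1 *: 'X = 2 - 'X :> {poly rat} by rewrite polyC_natr scaleN1r.
by have -> : 1%:P + 0 *: 'X = 1 :> {poly rat} by rewrite scale0r addr0.
Qed.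

Lemma lucas_vX_lead n :
  (size (lucas_v 'X 'X n : {poly rat}) <= n.+1)%N /\
  (lucas_v 'X 'X n.+1 : {poly rat})`_n.+1 = 1.
Proof.
have := @lucas_v_lead rat 0 1 0 1 n.
have -> : 0%:P + 1 *: 'X = 'X :> {poly rat} by rewrite add0r scale1r.
by rewrite expr1n.
Qed.

Lemma deriv_lucas_v1 n : (0 < n)%N ->
  (lucas_v1 (2 - 'X) n : {poly rat})^`() = - n%:R * lucas_u1 (2 - 'X) n.
Proof.
case: n => // n _; rewrite /lucas_v1 deriv_lucas_v derivB derivX.
have -> : (2 : {poly rat})^`() = 0 by rewrite -polyC_natr derivC.
have -> : (1 : {poly rat})^`() = 0 by rewrite -[1]/(1%:P) derivC.
by rewrite /lucas_u1; ring.
Qed.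

Section Prime.
Variable p : nat.
Hypotheses (p_prime : prime p) (p_gt3 : (3 < p)%N).

Let p_gt0 : (0 < p)%N := prime_gt0 p_prime.
Let p_gt2 : (2 < p)%N := ltnW p_gt3.
Let p0 : p%:R != 0 :> rat := natr_neq0 _ p_gt0.

Local Notation t := ('X : {poly rat}).
Local Notation U k := (lucas_u1 (2 - 'X : {poly rat}) k).
Local Notation V k := (lucas_v1 (2 - 'X : {poly rat}) k).
Local Notation u k := (lucas_u ('X : {poly rat}) 'X k).
Local Notation v k := (lucas_v ('X : {poly rat}) 'X k).
Local Notation theta P := ('X * (P : {poly rat})^`() - (p%:R : rat) *: P).

Let a j : rat := (-1) ^+ j * 'C(2 * p, p + j)%:R.
Let b j : rat := (-1) ^+ j * 'C(p, j)%:R.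

Let sign_p (R : pzRingType) : (-1) ^+ p = -1 :> R.
Proof.
by have [p2|odd_p] := even_prime p_prime; [lia | rewrite -signr_odd odd_p].
Qed.

(** * Expansions at index p in [U j] and [V j] *)

Lemma sign_natr_scale j n (f : {poly rat}) :
  (-1) ^+ j * n%:R * f = ((-1) ^+ j * n%:R : rat) *: f.
Proof. by rewrite -mul_polyC rmorphM rmorphXn rmorphN1 /= polyC_natr. Qed.

Let X_Zloc : t \is a polyOver (Zloc p). Proof. exact: polyOverX. Qed.

Let U_Zloc k : U k \is a polyOver (Zloc p).
Proof. by rewrite lucas_u_polyOver ?rpred1 // rpredB // rpred_nat. Qed.

Let V_Zloc k : V k \is a polyOver (Zloc p).
Proof. by rewrite lucas_v_polyOver ?rpred1 // rpredB // rpred_nat. Qed.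

Let u_Zloc k : u k \is a polyOver (Zloc p).
Proof. by rewrite lucas_u_polyOver. Qed.

(** Here and in the next three expansions the term j = p, of coefficient (-1)^p = -1 up to the outer
    sign, is split off; the estimates on [a j] and [b j] hold only for 0 < j < p. *)
Lemma sum_central_binE : \sum_(0 <= k < p) ('C(2 * k, k)%:R : rat) *: t ^+ (p - 1 - k) =
  U p - \sum_(1 <= j < p) a j *: U j.
Proof.
under eq_bigr do rewrite scaler_nat -mulr_natl.
rewrite sum_central_bin big_nat_recr //=; under eq_bigr do rewrite sign_natr_scale.
by rewrite sign_natr_scale addnn -mul2n binn sign_p mulr1 scaleN1r opprD opprK addrC.
Qed.

Lemma exp_pE : t ^+ p = 'C(2 * p, p)%:R - V p + \sum_(1 <= j < p) a j *: V j.
Proof.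
rewrite {1}(exp_central_bin _ t p) big_nat_recr //=.
under eq_bigr do rewrite sign_natr_scale.
by rewrite sign_natr_scale addnn -mul2n binn sign_p mulr1 scaleN1r addrA addrAC.
Qed.

Lemma lucas_u_pE : u p = U p - \sum_(1 <= j < p) b j *: U j.
Proof.
rewrite lucas_u_transform big_nat_recr //=; under eq_bigr do rewrite sign_natr_scale.
by rewrite sign_natr_scale binn sign_p mulr1 scaleN1r opprD opprK addrC.
Qed.

Lemma lucas_v_pE : v p = 2 - V p + \sum_(1 <= j < p) b j *: V j.
Proof.
rewrite lucas_v_transform big_nat_recr //= big_ltn // bin0 expr0 !mul1r.
under eq_bigr do rewrite sign_natr_scale.
by rewrite sign_natr_scale binn sign_p mulr1 scaleN1r -/(V p) addrAC.
Qed.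

(** * The first congruence and two companions modulo p^2 *)

Lemma sum_lucas_u_inv_sq : \sum_(1 <= k < p) (k%:R ^- 2 : rat) *: u k =
  - \sum_(1 <= j < p) bin_div2 p j *: U j.
Proof.
under eq_big_nat => k /andP[k_gt0 lt_kp].
  rewrite lucas_u_transform.
  (* Extending the inner range to j < p adds only zero terms and makes it independent of k, so the
     sums can be exchanged. *)
  have -> : \sum_(1 <= j < k.+1) (-1) ^+ j * 'C(k, j)%:R * lucas_u (2 - 'X) 1 j =
            \sum_(1 <= j < p) (-1) ^+ j * 'C(k, j)%:R * U j.
    rewrite [RHS](@big_cat_nat _ _ _ k.+1) //= [X in _ = _ + X]big_nat.
    rewrite [X in _ = _ + X]big1 ?addr0 // => j /andP[lt_kj _].
    by rewrite bin_small // mulr0 mul0r.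
  over.
under eq_bigr do rewrite scalerN scaler_sumr.
rewrite sumrN exchange_big_nat /=; congr (- _); apply: eq_bigr => j _.
rewrite /bin_div2 mulr_sumr scaler_suml; apply: eq_bigr => k _.
by rewrite sign_natr_scale scalerA; congr (_ *: _); ring.
Qed.

(** In the coefficient of [U j], the part 2 [b j] - [a j] is -2p^2 H_j/j modulo p^3. The correction
    sums cancel it, since 1/j^2 - [bin_div2 p j] is H_j/j modulo p. *)
Lemma sum_central_bin_cong : \sum_(0 <= k < p) ('C(2 * k, k)%:R : rat) *: t ^+ (p - 1 - k)
  - (2 * u p - U p
     - (2 * p%:R ^+ 2 : rat) *: \sum_(1 <= k < p) (k%:R ^- 2 : rat) *: (U k + u k))
  \is a polyOver (Zpow p 3).
Proof.
rewrite sum_central_binE lucas_u_pE.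
under [X in _ *: X]eq_bigr do rewrite scalerDr.
rewrite big_split /= sum_lucas_u_inv_sq.
pose c j := 2 * b j - a j + 2 * p%:R ^+ 2 * (j%:R ^- 2 - bin_div2 p j).
have -> : U p - \sum_(1 <= j < p) a j *: U j -
    (2 * (U p - \sum_(1 <= j < p) b j *: U j) - U p -
     (2 * p%:R ^+ 2) *: (\sum_(1 <= j < p) j%:R ^- 2 *: U j +
        - \sum_(1 <= j < p) bin_div2 p j *: U j)) = \sum_(1 <= j < p) c j *: U j.
  have -> : \sum_(1 <= j < p) c j *: U j =
      2 * (\sum_(1 <= j < p) b j *: U j) - \sum_(1 <= j < p) a j *: U j +
     (2 * p%:R ^+ 2) *: (\sum_(1 <= j < p) j%:R ^- 2 *: U j
        - \sum_(1 <= j < p) bin_div2 p j *: U j).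
    rewrite mulr_sumr -!sumrB scaler_sumr -big_split; apply: eq_bigr => j _ /=.
    by rewrite /c -!mul_polyC; ring.
  by ring.
rewrite big_nat rpred_sum // => j j_int; apply: polyOver_ZpowZ => //.
have [ca caZ aE] := bin_double_prime _ p_prime _ p_gt2 j_int.
have [cb cbZ bE] := bin_prime _ p_prime _ j_int.
have [cd cdZ dE] := bin_div2_prime _ p_prime p_gt2 _ j_int.
apply/ZpowP => //; exists (2 * cb - ca - 2 * cd).
  by rewrite !(rpredD, rpredN, rpredM, rpred1, rpred_nat).
rewrite /c /a /b aE bE dE; case: j j_int {aE bE dE} => // j _.
by rewrite harmS /=; field; rewrite nat1r natr_neq0.
Qed.

(** The terms in [V p] cancel, and both 2 - C(2p, p) and 2 [b j] - [a j] vanish modulo p^2. *)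
Lemma lucas_v_cong : V p + 2 * v p - t ^+ p - 2 \is a polyOver (Zpow p 2).
Proof.
rewrite exp_pE lucas_v_pE.
have -> : V p + 2 * (2 - V p + \sum_(1 <= j < p) b j *: V j)
   - ('C(2 * p, p)%:R - V p + \sum_(1 <= j < p) a j *: V j) - 2 =
   (2 - 'C(2 * p, p)%:R : rat)%:P + \sum_(1 <= j < p) (2 * b j - a j) *: V j.
  have -> : \sum_(1 <= j < p) (2 * b j - a j) *: V j =
      2 * (\sum_(1 <= j < p) b j *: V j) - \sum_(1 <= j < p) a j *: V j.
    rewrite mulr_sumr -!sumrB; apply: eq_bigr => j _ /=.
    by rewrite -!mul_polyC; ring.
  by rewrite polyCB !polyC_natr; ring.
rewrite rpredD //.
  rewrite polyOverC; have [c cZ ->] := central_bin_prime _ p_prime.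
  by apply/ZpowP => //; exists (- c); [rewrite rpredN | ring].
rewrite big_nat rpred_sum // => j j_int; apply: polyOver_ZpowZ => //.
have [ca caZ aE] := bin_double_prime _ p_prime _ p_gt2 j_int.
have [cb cbZ bE] := bin_prime _ p_prime _ j_int.
have jZ : j%:R^-1 \in Zloc p by rewrite Zloc_inv_lt.
have hZ : harm j \in Zloc p by rewrite harm_Zloc //; case/andP: j_int.
apply/ZpowP => //; exists (p%:R * (2 * cb - ca) - 2 * harm j * j%:R^-1).
  by rewrite !(rpredD, rpredN, rpredM, rpred1, rpred_nat).
by rewrite /a /b aE bE; field; case/andP: j_int => j_gt0 _; rewrite natr_neq0.
Qed.

(** Since [b j] is -p/j modulo p^2. The third congruence needs this for the quotient of [u p - U p]
    by p. *)
Lemma lucas_u_cong :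
  u p - U p - (p%:R : rat) *: \sum_(1 <= j < p) (j%:R^-1 : rat) *: U j
  \is a polyOver (Zpow p 2).
Proof.
rewrite lucas_u_pE.
have -> : U p - \sum_(1 <= j < p) b j *: U j - U p
     - p%:R *: \sum_(1 <= j < p) j%:R^-1 *: U j =
    \sum_(1 <= j < p) (- b j - p%:R / j%:R) *: U j.
  have -> : \sum_(1 <= j < p) (- b j - p%:R / j%:R) *: U j =
     - (\sum_(1 <= j < p) b j *: U j) - p%:R *: \sum_(1 <= j < p) j%:R^-1 *: U j.
    rewrite scaler_sumr -sumrN -sumrB; apply: eq_bigr => j _.
    by rewrite scalerBl scaleNr scalerA.
  by ring.
rewrite big_nat rpred_sum // => j j_int; apply: polyOver_ZpowZ => //.
have [cb cbZ bE] := bin_prime _ p_prime _ j_int.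
have jZ : j%:R^-1 \in Zloc p by rewrite Zloc_inv_lt.
have hZ : harm j \in Zloc p by rewrite harm_Zloc //; case/andP: j_int.
apply/ZpowP => //; exists (j%:R^-1 ^+ 2 - harm j * j%:R^-1 - p%:R * cb).
  by rewrite !(rpredD, rpredN, rpredM, rpredX, rpred1, rpred_nat).
by rewrite /b bE; field; case/andP: j_int => j_gt0 _; rewrite natr_neq0.
Qed.

(** * The operator t d/dt - p and the second congruence *)

Lemma thetaZ c P : theta (c *: P) = c *: theta P.
Proof. by rewrite derivZ -!mul_polyC; ring. Qed.

Lemma theta_sum_Xn (c : nat -> rat) :
  theta (\sum_(1 <= k < p) c k *: t ^+ (p - k)) =
  - \sum_(1 <= k < p) (k%:R * c k) *: t ^+ (p - k).
Proof.
rewrite raddf_sum mulr_sumr scaler_sumr -sumrB -sumrN; apply: eq_big_nat.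
move=> k /andP[_ lt_kp] /=; rewrite derivZ derivXn.
have [n nE] : {n | p - k = n.+1}%N by exists (p - k).-1; lia.
have -> : p%:R = n.+1%:R + k%:R :> rat by rewrite -natrD; congr _%:R; lia.
rewrite nE /= exprS -mulr_natl -!mul_polyC !rmorphD !rmorphM /= !polyC_natr; ring.
Qed.

Lemma coef_sum_Xn (c : nat -> rat) j : (j == 0)%N || (p <= j)%N ->
  (\sum_(1 <= k < p) c k *: t ^+ (p - k))`_j = 0.
Proof.
move=> j_out; rewrite coef_sum big_nat big1 // => k /andP[k_gt0 lt_kp].
rewrite coefZ coefXn; have -> : (j == p - k)%N = false by lia.
by rewrite mulr0.
Qed.

Lemma deriv_lucas_vp : (v p)^`() = p%:R * (u p - u p.-1).
Proof. by rewrite -(prednK p_gt0) deriv_lucas_v derivX !mulr1. Qed.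

Lemma lucas_vpE : v p = t * u p - 2 * t * u p.-1.
Proof. by rewrite -(prednK p_gt0) lucas_vE. Qed.

Lemma mulX_derivXp : t * (t ^+ p)^`() = p%:R * t ^+ p.
Proof. by rewrite derivXn -mulr_natl mulrCA -exprS prednK. Qed.

Let A : {poly rat} := \sum_(1 <= k < p) ('C(2 * k, k)%:R / k%:R : rat) *: t ^+ (p - k).
Let R2 : {poly rat} := (p%:R^-1 : rat) *: (3 * t ^+ p + 2 - V p - 4 * v p).

Let deriv2 : (2 : {poly rat})^`() = 0.
Proof. by rewrite -polyC_natr derivC. Qed.

(** Both t d/dt and multiplication by p yield a factor p on each term, which cancels the denominator
    of [R2]. *)
Lemma theta_R2 : theta R2 = t * U p + V p - 2 - 4 * t * u p.-1.
Proof.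
rewrite /R2 thetaZ.
have -> : theta (3 * t ^+ p + 2 - V p - 4 * v p) =
    (p%:R : rat) *: (t * U p + V p - 2 - 4 * t * u p.-1).
  have -> : 4 * v p = 4%:P * v p by rewrite polyC_natr.
  have -> : 3 * t ^+ p = 3%:P * t ^+ p by rewrite polyC_natr.
  rewrite !derivB derivD !mul_polyC !derivZ deriv2 deriv_lucas_v1 // deriv_lucas_vp.
  rewrite -!mul_polyC !polyC_natr.
  have -> (x y z : {poly rat}) : 'X * (3 * (t ^+ p)^`() + x - y - z) =
    3 * ('X * (t ^+ p)^`()) + 'X * (x - y - z) by ring.
  by rewrite mulX_derivXp lucas_vpE; ring.
by rewrite scalerA mulVf // scale1r.
Qed.

(** The eigenvalue -k on t^(p-k) cancels 1/k; the term t^p compensates for k = 0 in the full central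
    sum. *)
Lemma theta_A : theta A = t ^+ p -
  t * \sum_(0 <= k < p) ('C(2 * k, k)%:R : rat) *: t ^+ (p - 1 - k).
Proof.
rewrite /A theta_sum_Xn [X in _ - t * X]big_ltn // bin0 scale1r subn0 mulrDr.
rewrite -exprS subn1 prednK //.
rewrite opprD addrA subrr sub0r; congr (- _); rewrite mulr_sumr.
apply: eq_big_nat => k /andP[k_gt0 lt_kp].
rewrite mulrC divfK ?natr_neq0 // -scalerAr -exprS.
by congr (_ *: _ ^+ _); lia.
Qed.

(** Integrates the first congruence by [polyOver_theta]. The two coefficients lost by the operator
    vanish exactly: 2 - 2 = 0 at t^0 and 3 + 1 - 4 = 0 at t^p. *)
Lemma sum_central_bin_div_cong : A - R2 \is a polyOver (Zpow p 2).
Proof.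
have [szV Vp] := lucas_v1_lead p.-1; have [szV' _] := lucas_v1_lead p.
have [szv vp] := lucas_vX_lead p.-1; have [szv' _] := lucas_vX_lead p.
rewrite !prednK // sign_p in Vp vp.
have coefR2 j : R2`_j = p%:R^-1 * (3 * (j == p)%N%:R + 2 *+ (j == 0)%N
     - (V p)`_j - 4 * (v p)`_j).
  rewrite /R2 coefZ; congr (_ * _).
  have -> : 4 * v p = 4 *: v p by rewrite -mul_polyC polyC_natr.
  have -> : 3 * t ^+ p = 3 *: t ^+ p by rewrite -mul_polyC polyC_natr.
  by rewrite !coefB coefD !coefZ coefXn coef_natr.
apply: polyOver_theta => //.
- apply/leq_sizeP => j lt_pj; rewrite coefB coef_sum_Xn ?(ltnW lt_pj) ?orbT //.
  rewrite coefR2 !nth_default ?(leq_trans _ lt_pj) //; have -> : (j == p) = false by lia.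
  have -> : (j == 0)%N = false by lia.
  by rewrite /=; ring.
- rewrite coefB coef_sum_Xn // coefR2 coef0_lucas_v -{3}(prednK p_gt0).
  rewrite coef0_lucas_vX; have -> : (0 == p)%N = false by lia.
  by rewrite (_ : _ - _ = 0) ?rpred0 //=; ring.
- rewrite coefB coef_sum_Xn ?leqnn ?orbT // coefR2 Vp vp eqxx.
  have -> : (p == 0)%N = false by lia.
  by rewrite (_ : _ - _ = 0) ?rpred0 //=; ring.
have -> : theta (A - R2) = theta A - theta R2 by rewrite derivB -!mul_polyC; ring.
rewrite theta_A theta_R2; set B := \sum_(0 <= k < p) _.
(* Modulo p^2 the correction of the first congruence disappears, being 2p^2 times a p-integral
   polynomial. *)
have BZ : B - (2 * u p - U p) \is a polyOver (Zpow p 2).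
  have := sum_central_bin_cong; rewrite -/B.
  set S := \sum_(1 <= k < p) _ => BZ.
  have SZ : S \is a polyOver (Zloc p).
    rewrite /S big_nat rpred_sum // => k k_int.
    by rewrite polyOverZ ?rpredD // -exprVn rpredX // Zloc_inv_lt.
  have -> : B - (2 * u p - U p) =
     (B - (2 * u p - U p - (2 * p%:R ^+ 2) *: S)) - (2 * p%:R ^+ 2) *: S by ring.
  rewrite rpredB //.
    by apply/polyOverP => i; rewrite (Zpow_leq _ _ 3) // (polyOverP BZ).
  apply: polyOver_ZpowZ => //; apply/ZpowP => //; exists 2; [exact: rpred_nat | ring].
have -> : t ^+ p - t * B - (t * U p + V p - 2 - 4 * t * u p.-1) =
   - ((B - (2 * u p - U p)) * t) - (V p + 2 * v p - t ^+ p - 2).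
  by rewrite lucas_vpE; ring.
by rewrite rpredB ?rpredN ?polyOver_ZpowM // lucas_v_cong.
Qed.

(** * The third congruence *)

Let L : {poly rat} :=
  \sum_(1 <= k < p) ('C(2 * k, k)%:R / k%:R ^+ 2 : rat) *: t ^+ (p - k).
Let E : {poly rat} := V p + 2 * v p - t ^+ p - 2.
Let S3 : {poly rat} := \sum_(1 <= k < p) (k%:R ^- 2 : rat) *: V k.

Lemma theta_L : theta L = - A.
Proof.
rewrite /L theta_sum_Xn; congr (- _); apply: eq_big_nat => k /andP[k_gt0 _].
by congr (_ *: _); field; rewrite natr_neq0.
Qed.

Lemma theta_E : theta E = (p%:R : rat) *: (t * u p - t * U p + v p - t ^+ p - E).
Proof.
rewrite /E; have -> : 2 * v p = 2%:P * v p by rewrite polyC_natr.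
rewrite !derivB derivD !mul_polyC !derivZ deriv2 deriv_lucas_v1 // deriv_lucas_vp.
rewrite -!mul_polyC !polyC_natr.
have -> (x y : {poly rat}) : 'X * (x - (t ^+ p)^`() - y) =
    'X * (x - y) - 'X * (t ^+ p)^`() by ring.
by rewrite mulX_derivXp lucas_vpE; ring.
Qed.

(** Differentiation turns V_k/k^2 into -U_k/k, so the sum of [lucas_u_cong] appears. *)
Lemma theta_S3 : theta S3 = - t * (\sum_(1 <= k < p) (k%:R^-1 : rat) *: U k) - p%:R *: S3.
Proof.
rewrite /S3; congr (_ - _); rewrite raddf_sum mulNr -mulrN -sumrN; congr (_ * _).
apply: eq_big_nat => k /andP[k_gt0 _] /=; rewrite derivZ deriv_lucas_v1 //.
have -> : - k%:R * U k = (- k%:R : rat) *: U k.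
  by rewrite -mul_polyC polyCN polyC_natr.
by rewrite scalerA -scaleNr; congr (_ *: _); field; rewrite natr_neq0.
Qed.

Lemma sum_central_bin_div2_cong :
  2^-1 *: L - (p%:R ^- 2 *: E + S3) \is a polyOver (Zpow p 1).
Proof.
have [szV Vp] := lucas_v1_lead p.-1; have [szV' _] := lucas_v1_lead p.
have [szv vp] := lucas_vX_lead p.-1; have [szv' _] := lucas_vX_lead p.
rewrite !prednK // sign_p in Vp vp.
have coefE j : E`_j = (V p)`_j + 2 * (v p)`_j - (j == p)%N%:R - 2 *+ (j == 0)%N.
  rewrite /E; have -> : 2 * v p = 2 *: v p by rewrite -mul_polyC polyC_natr.
  by rewrite !coefB coefD !coefZ coefXn coef_natr.
have S3_ge j : (p <= j)%N -> S3`_j = 0.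
  move=> le_pj; rewrite coef_sum big_nat big1 // => k /andP[_ lt_kp].
  have [szVk _] := lucas_v1_lead k.
  by rewrite coefZ nth_default ?mulr0 // (leq_trans szVk) // (leq_trans lt_kp).
have E_0 : E`_0 = 0.
  rewrite coefE coef0_lucas_v -{1}(prednK p_gt0) coef0_lucas_vX.
  have -> : (0 == p)%N = false by lia.
  by rewrite /=; ring.
apply: polyOver_theta => //.
- apply/leq_sizeP => j lt_pj; rewrite coefB coefD !coefZ.
  rewrite coef_sum_Xn ?(ltnW lt_pj) ?orbT //.
  rewrite S3_ge ?(ltnW lt_pj) // coefE.
  rewrite !nth_default ?(leq_trans _ lt_pj) //; have -> : (j == p) = false by lia.
  have -> : (j == 0)%N = false by lia.
  by rewrite /=; ring.
(* The constant coefficient is, up to sign, twice the sum of 1/k^2; it vanishes only modulo p, by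
   [sum_inv_sq_prime]. *)
- rewrite coefB coefD !coefZ coef_sum_Xn // E_0 !mulr0 !add0r rpredN.
  rewrite coef_sum; under eq_bigr do rewrite coefZ coef0_lucas_v.
  by rewrite -mulr_suml ZpowM ?rpred_nat // sum_inv_sq_prime.
- rewrite coefB coefD !coefZ coef_sum_Xn ?leqnn ?orbT // S3_ge // coefE Vp vp eqxx.
  have -> : (p == 0)%N = false by lia.
  by rewrite (_ : _ - _ = 0) ?rpred0 //=; ring.
have -> : theta (2^-1 *: L - (p%:R ^- 2 *: E + S3)) =
    2^-1 *: theta L - p%:R ^- 2 *: theta E - theta S3.
  by rewrite derivB derivD !derivZ -!mul_polyC; ring.
rewrite theta_L theta_E theta_S3; set S1 := \sum_(1 <= k < p) _ *: U k.
(* [theta E] is rewritten through [Q], which is p times [R2], and [E], using [Q + 3 * E] = 2 (t^p +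
   [E] - [v p]). The half of [R2] then pairs with -[A]/2, and every summand is covered by an earlier
   congruence or a factor p. *)
have -> : 2^-1 *: (- A)
    - p%:R ^- 2 *: (p%:R *: (t * u p - t * U p + v p - t ^+ p - E))
    - (- t * S1 - p%:R *: S3) =
  (- 2^-1) *: (A - R2) + (3 / 2) *: (p%:R^-1 *: E) + p%:R *: S3
    - (p%:R^-1 *: (u p - U p - p%:R *: S1)) * t.
  set Q := 3 * t ^+ p + 2 - V p - 4 * v p.
  have QE : Q + 3 * E = 2%:P * (t ^+ p + E - v p) by rewrite polyC_natr /Q /E; ring.
  have -> : t * u p - t * U p + v p - t ^+ p - E =
      t * (u p - U p) - 2^-1 *: (Q + 3 * E).
    by rewrite QE mul_polyC scalerA mulVf // scale1r; ring.
  have pV2 : p%:R ^- 2 * p%:R = p%:R^-1 :> rat by field.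
  rewrite [p%:R ^- 2 *: _]scalerA pV2 /R2 -/Q [p%:R^-1 *: (_ - p%:R *: S1)]scalerBr.
  by rewrite [p%:R^-1 *: (p%:R *: S1)]scalerA mulVf // scale1r -!mul_polyC; ring.
have n2 : 2^-1 \in Zloc p by rewrite (Zloc_inv_lt _ p_prime 2).
have scaleZ c m (P : {poly rat}) : c \in Zloc p ->
    P \is a polyOver (Zpow p m) -> c *: P \is a polyOver (Zpow p m).
  by move=> cZ PZ; rewrite -mul_polyC mulrC polyOver_ZpowM // polyOverC.
rewrite rpredB ?polyOver_ZpowM ?polyOver_Zpow_divp ?lucas_u_cong //.
rewrite !rpredD //.
- apply: scaleZ; first by rewrite rpredN.
  apply/polyOverP => i; rewrite (Zpow_leq _ _ 2) //.
  exact: (polyOverP sum_central_bin_div_cong).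
- apply: scaleZ; first by rewrite rpredM ?rpred_nat.
  by rewrite polyOver_Zpow_divp ?lucas_v_cong.
apply: polyOver_ZpowZ; first by apply/ZpowP => //; exists 1; rewrite ?rpred1 // mulr1.
rewrite /S3 big_nat rpred_sum // => k k_int.
by rewrite polyOverZ // -exprVn rpredX // Zloc_inv_lt.
Qed.

End Prime.

Theorem theorem7p1 (p : nat) (p_prime : prime p) (p_gt3 : (3 < p)%N) :
  let t : {poly rat} := 'X in
  [/\ polycong p 3
        (\sum_(0 <= k < p) ('C(2 * k, k)%:R : rat) *: t ^+ (p - 1 - k))
        (2 * lucas_u t t p - lucas_u1 (2 - t) p
         - (2 * p%:R ^+ 2 : rat) *:
             \sum_(1 <= k < p)
                (k%:R ^- 2 : rat) *: (lucas_u1 (2 - t) k + lucas_u t t k)),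
      polycong p 2
        (\sum_(1 <= k < p) ('C(2 * k, k)%:R / k%:R : rat) *: t ^+ (p - k))
        ((p%:R^-1 : rat) *:
           (3 * t ^+ p + 2 - lucas_v1 (2 - t) p - 4 * lucas_v t t p))
    & polycong p 1
        ((2^-1 : rat) *:
           \sum_(1 <= k < p) ('C(2 * k, k)%:R / k%:R ^+ 2 : rat) *: t ^+ (p - k))
        ((p%:R ^- 2 : rat) *:
           (lucas_v1 (2 - t) p + 2 * lucas_v t t p - t ^+ p - 2)
         + \sum_(1 <= k < p) (k%:R ^- 2 : rat) *: lucas_v1 (2 - t) k)].
Proof.
have p_gt0 := prime_gt0 p_prime.
split; apply: polycongP => //.
- exact: sum_central_bin_cong.
- exact: sum_central_bin_div_cong.
- exact: sum_central_bin_div2_cong.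
Qed.
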